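(* Let $q\in\mathbb N$, $a_1,\dots,a_q\in\mathbb R$ and $\sigma_1,\dots,\sigma_q\ge0$. Let $\{\eta_{in}:1\le i\le q,\ n\in\mathbb N\}\cup\{\xi_n:n\in\mathbb N\}$ be independent $\mathcal N(0,1)$ random variables, let $(y_0,\dots,y_{-q+1})$ be a random vector independent of all of them, and define $$y_n=(a_1+\sigma_1\eta_{1n})y_{n-1}+\dots+(a_q+\sigma_q\eta_{qn})y_{n-q}+\xi_n,\qquad n\in\mathbb N.$$ Let $(\varepsilon_n)_{n\in\mathbb N}$ be i.i.d. $\mathcal N(0,1)$ random variables, let $(x_0,\dots,x_{-q+1})=(y_0,\dots,y_{-q+1})$ be independent of $(\varepsilon_n)_{n\in\mathbb N}$, and define $$x_n=a_1x_{n-1}+\dots+a_qx_{n-q}+\sqrt{1+\sigma_1^2x_{n-1}^2+\dots+\sigma_q^2x_{n-q}^2}\;\varepsilon_n,\qquad n\in\mathbb N.$$ Then the stochastic processes $(x_n)_{n\ge0}$ and $(y_n)_{n\ge0}$ have the same distribution.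
   Context: $\mathcal N(0,1)$ is the standard normal distribution. ''Same distribution'' means equality of laws of the processes (equivalently, of all finite-dimensional distributions). *)

(* Defs.v *)
From HB Require Import structures.
From mathcomp Require Export all_boot all_order all_algebra.
From mathcomp Require Export all_classical all_reals all_analysis.
Export Order.TTheory GRing.Theory Num.Theory.
Export numFieldNormedType.Exports.

Set Implicit Arguments.
Unset Strict Implicit.
Unset Printing Implicit Defensive.

Local Open Scope classical_set_scope.
Local Open Scope ring_scope.

Definition generated_sigma_algebra {R : realType} {T I : Type}
    (X : I -> T -> R) : set (set T) :=
  <<s \bigcup_i preimage_set_system [set: T] (X i) measurable >>.

Definition mutually_independent {d : measure_display} {T : measurableType d}
    {R : realType} (P : probability T R) {I : eqType}
    (X : I -> {RV P >-> R}) : Prop :=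
  forall (s : seq I) (A : I -> set R), uniq s ->
    (forall i, measurable (A i)) ->
    P (\bigcap_(i in [set` s]) X i @^-1` A i) =
      (\prod_(i <- s) P (X i @^-1` A i))%E.

(* Independence of the two families as a whole (not of their members taken
   pairwise); each family may be dependent internally. *)
Definition independent_families {d : measure_display} {T : measurableType d}
    {R : realType} (P : probability T R) {I J : Type}
    (X : I -> {RV P >-> R}) (Y : J -> {RV P >-> R}) : Prop :=
  forall A B : set T,
    generated_sigma_algebra X A -> generated_sigma_algebra Y B ->
    P (A `&` B) = (P A * P B)%E.

(* The equality is required on Borel sets only: the values of a measure
   outside its sigma-algebra are junk. *)
Definition standard_normal {d : measure_display} {T : measurableType d}
    {R : realType} (P : probability T R) (X : {RV P >-> R}) : Prop :=
  forall A : set R, measurable A -> distribution P X A = normal_prob 0 1 A.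

Definition process_law {d : measure_display} {T : measurableType d}
    {R : realType} (P : probability T R) (X : nat -> T -> R)
    (A : set (nat -> R)) : \bar R :=
  P ((fun w n => X n w) @^-1` A).

(* The laws live on the path space [nat -> R] with its product sigma-algebra,
   i.e. the one generated by the coordinate maps. *)
Definition same_distribution {d : measure_display} {T : measurableType d}
    {R : realType} (P : probability T R) (X Y : nat -> T -> R) : Prop :=
  forall A : set (nat -> R),
    generated_sigma_algebra (fun (n : nat) (f : nat -> R) => f n) A ->
    process_law P X A = process_law P Y A.

Definition join_families {U I J : Type} (X : I -> U) (Y : J -> U)
    (k : I + J) : U :=
  match k with inl i => X i | inr j => Y j end.

(* Main.v *)
(* Conditionally on the past, the new value of either process is normal with
   mean [sum_i a_i h_i] and variance [1 + sum_i sigma_i^2 h_i^2], where [h]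
   lists the previous values: for [y] because a sum of independent centred normal
   variables is normal and the variances add up. The noise at time [n] being
   independent of the past, both histories are thus Markov chains with the same
   initial law and the same transition probabilities, so they have the same law
   at each time, and these laws determine the law of the process. *)
From HB Require Import structures.
Require Import Defs.
From mathcomp Require Import measurable_realfun ring.

Set Implicit Arguments.
Unset Strict Implicit.
Unset Printing Implicit Defensive.

Local Open Scope classical_set_scope.
Local Open Scope ring_scope.

(** * Sigma-algebras and independence *)

(** Dynkin's uniqueness theorem for measures of equal finite mass. Here [G] need not cover the
    space: adding [setT] keeps it closed under intersection and provides the constant exhausting
    sequence. *)
Lemma eq_finite_measure_pi d (T : measurableType d) (R : realType)
    (m1 m2 : {measure set T -> \bar R}) (G : set (set T)) :
  G `<=` measurable -> setI_closed G -> m1 setT = m2 setT ->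
  (m1 setT < +oo)%E -> (forall A, G A -> m1 A = m2 A) ->
  forall A, <<s G >> A -> m1 A = m2 A.
Proof.
move=> mG GI m12T m1T m12 A sGA.
pose G' := G `|` [set setT].
have GG' : <<s G >> `<=` <<s G' >>.
  by apply: sub_sigma_algebra2; exact: subsetUl.
apply: (g_sigma_algebra_measure_unique G' _ (fun=> setT)) => //.
- by move=> B [/mG//|->]; exact: measurableT.
- by move=> _; right.
- by rewrite bigcup_const//; exists 0%N.
- move=> B C [GB|->] [GC|->]; rewrite ?setIT ?setTI.
  + by left; exact: GI.
  + by left.
  + by left.
  + by right.
- by move=> B [/m12//|->].
- exact: GG'.
Qed.

Section generated_sigma_algebras.
Context {R : realType} {T I : Type}.
Implicit Types (X : I -> T -> R) (J : set I).

(** For [J = setT] this is [generated_sigma_algebra X]. *)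
Definition sigma_of X J : set (set T) :=
  <<s \bigcup_(i in J) preimage_set_system [set: T] (X i) measurable >>.

Lemma sigma_of_preimage X J i (A : set R) :
  J i -> measurable A -> sigma_of X J (X i @^-1` A).
Proof.
move=> Ji mA; apply: sub_sigma_algebra; exists i => //.
by exists A => //; rewrite setTI.
Qed.

Lemma sub_sigma_of X J K : J `<=` K -> sigma_of X J `<=` sigma_of X K.
Proof. by move=> JK; apply: sub_sigma_algebra2; exact: bigcup_subset. Qed.

(** A pi-system that generates [sigma_of X J]. The family [A] is total, but only its values on [D]
    matter. *)
Definition cylinder X J : set (set T) :=
  [set C | exists (D : set I) (A : I -> set R), [/\ finite_set D, D `<=` J,
     (forall i, measurable (A i)) & C = \bigcap_(i in D) X i @^-1` A i]].

Lemma cylinder_setI X J : setI_closed (cylinder X J).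
Proof.
move=> _ _ [D [A [fD DJ mA ->]]] [E [B [fE EJ mB ->]]].
(* Padding with [setT] lets both cylinders be written over the common index set [D] united with
   [E]. *)
pose A' i := if i \in D then A i else setT.
pose B' i := if i \in E then B i else setT.
exists (D `|` E), (fun i => A' i `&` B' i); split.
- by rewrite finite_setU.
- by move=> i [/DJ|/EJ].
- by move=> i; apply: measurableI; rewrite /A' /B'; case: ifP.
- apply/seteqP; split => w /=.
  + move=> [wA wB] i _ /=; split; rewrite /A' /B'; case: ifPn => //;
      rewrite inE.
    * exact: wA.
    * exact: wB.
  + move=> wAB; split => i Di; [have [+ _] := wAB i (or_introl Di)
                               |have [_ +] := wAB i (or_intror Di)].
    * by rewrite /A' mem_set.
    * by rewrite /B' mem_set.
Qed.

Lemma sigma_of_cylinder X J : sigma_of X J `<=` <<s cylinder X J >>.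
Proof.
apply: sub_sigma_algebra2.
move=> _ [i Ji [A mA <-]].
exists [set i], (fun=> A); split => //.
- by move=> _ ->.
- by rewrite bigcap_set1 setTI.
Qed.

End generated_sigma_algebras.

Lemma sigma_of_measurable d (T : measurableType d) (R : realType) I
    (X : I -> {mfun T >-> R}) (J : set I) : sigma_of X J `<=` measurable.
Proof.
apply: smallest_sub; first exact: sigma_algebra_measurable.
by move=> _ [i _ [A mA <-]]; exact: measurable_funPT.
Qed.

Lemma cylinder_measurable d (T : measurableType d) (R : realType) I
    (X : I -> {mfun T >-> R}) (J : set I) : cylinder X J `<=` measurable.
Proof.
move=> _ [D [A [fD _ mA ->]]]; apply: fin_bigcap_measurable => // i _.
by rewrite -[_ @^-1` _]setTI; exact: measurable_funPT.
Qed.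

Section independence.
Context d (T : measurableType d) (R : realType) (P : probability T R).
Implicit Types F G : set (set T).

Definition indep_systems F G :=
  forall A B, F A -> G B -> P (A `&` B) = (P A * P B)%E.

Lemma indep_systems_sym F G : indep_systems F G -> indep_systems G F.
Proof. by move=> FG A B GA FB; rewrite setIC muleC FG. Qed.

(** For fixed [B] in [G], the maps sending [A] to [P (A]&[B)] and to [P A * P B] are finite measures
    of the same mass that agree on the pi-system [F]. *)
Lemma indep_systems_sigma F G : F `<=` measurable -> setI_closed F ->
  G `<=` measurable -> indep_systems F G -> indep_systems <<s F >> G.
Proof.
move=> mF FI mG FG A B sFA GB; have mB := mG _ GB.
have PB0 : 0 <= fine (P B) by rewrite fine_ge0.
have PBE : P B = (NngNum PB0)%:num%:E by rewrite /= fineK// fin_num_measure.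
rewrite [RHS]muleC PBE.
apply: (@eq_finite_measure_pi _ _ _ (mrestr P mB)
  (mscale (NngNum PB0) P) F) => //.
- rewrite /= /mrestr /mscale/= setTI probability_setT mule1.
  by rewrite fineK// fin_num_measure.
- by rewrite /= /mrestr/= setTI -ge0_fin_numE// fin_num_measure.
- move=> C FC; rewrite /= /mrestr /mscale/= FG// muleC fineK//.
  by rewrite fin_num_measure.
Qed.

End independence.

(** Cylinders over disjoint index sets are independent by the product formula; the extension to
    sigma-algebras is made on one side, then, by symmetry, on the other. *)
Lemma mutually_independent_sigma_of d (T : measurableType d) (R : realType)
    (P : probability T R) (I : eqType) (X : I -> {RV P >-> R}) (J K : set I) :
  mutually_independent X -> J `&` K = set0 ->
  indep_systems P (sigma_of X J) (sigma_of X K).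
Proof.
move=> indX JK.
suff cyl : indep_systems P (cylinder X J) (cylinder X K).
  have mJ := @cylinder_measurable _ _ _ _ X J.
  have mK := @cylinder_measurable _ _ _ _ X K.
  have {}cyl := indep_systems_sigma mJ (@cylinder_setI _ _ _ _ _) mK cyl.
  have mJ' : <<s cylinder X J >> `<=` measurable.
    by apply: smallest_sub => //; exact: sigma_algebra_measurable.
  have {}cyl := indep_systems_sigma mK (@cylinder_setI _ _ _ _ _) mJ'
    (indep_systems_sym cyl).
  move=> A B /sigma_of_cylinder sA /sigma_of_cylinder sB.
  by rewrite setIC muleC cyl.
move=> _ _ [D [A [/finite_seqP[s ->] sJ mA ->]]]
  [E [B [/finite_seqP[t ->] tK mB ->]]].
(* One family of events for both cylinders, as the product formula takes a single family; the index
   sets being disjoint, [C] is [B] on [t]. Duplicates are removed because the formula concerns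
   sequences without repetition. *)
pose C i := if i \in s then A i else B i.
have disj i : i \in s -> i \in t -> False.
  by move=> si ti; have : (J `&` K) i by [split; [exact: sJ|exact: tK]];
     rewrite JK.
have As : \bigcap_(i in [set` s]) X i @^-1` A i =
          \bigcap_(i in [set` undup s]) X i @^-1` C i.
  by apply/seteqP; split => w wA i /=; [rewrite mem_undup|] => si;
     have := wA i; rewrite /= ?mem_undup /C si; exact.
have Bt : \bigcap_(i in [set` t]) X i @^-1` B i =
          \bigcap_(i in [set` undup t]) X i @^-1` C i.
  apply/seteqP; split => w wA i /=; [rewrite mem_undup|] => ti;
     have := wA i; rewrite /= ?mem_undup /C; case: ifPn => // si;
     by [exfalso; exact: disj ti|exact].
have mC i : measurable (C i) by rewrite /C; case: ifP.
rewrite As Bt !indX ?undup_uniq// -big_cat/= -indX//.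
  by rewrite -bigcap_setU; congr (P (bigcap _ _)); apply/seteqP; split => i /=;
     rewrite mem_cat => /orP.
rewrite cat_uniq !undup_uniq/= andbT; apply/hasPn => i.
by rewrite !mem_undup => ti; apply/negP => si; exact: disj ti.
Qed.

(** The set [T] with [sigma_of X J] as its measurable sets: [measurable_fun] on this type expresses
    measurability with respect to a sub-sigma-algebra. *)
Definition sub_space {R : realType} {T I : Type} (X : I -> T -> R)
    (J : set I) :=
  g_sigma_algebraType
    (\bigcup_(i in J) preimage_set_system [set: T] (X i) measurable).

Section sub_space_theory.
Context d (T : measurableType d) (R : realType) (I : Type)
  (X : I -> {mfun T >-> R}).
Implicit Types J K : set I.

Lemma sub_space_coord J i : J i ->
  measurable_fun setT (X i : sub_space X J -> R).
Proof. by move=> Ji _ A mA; rewrite setTI; exact: sigma_of_preimage. Qed.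

Lemma sub_space_id J : measurable_fun setT (id : T -> sub_space X J).
Proof. by move=> _ A mA; rewrite setTI; exact: sigma_of_measurable mA. Qed.

Lemma sub_space_comap K (I' : Type) (X' : I' -> {mfun T >-> R}) (J : set I') :
  sigma_of X K `<=` sigma_of X' J ->
  measurable_fun setT (id : sub_space X' J -> sub_space X K).
Proof. by move=> KJ _ A mA; rewrite setTI; exact: KJ. Qed.

Lemma sub_space_measurable_fun J d' (T' : measurableType d') (f : T -> T') :
  measurable_fun setT (f : sub_space X J -> T') -> measurable_fun setT f.
Proof.
by move=> mf mT A mA; apply: (@sigma_of_measurable _ _ _ _ X J); exact: mf.
Qed.

Lemma sub_space_preimage J d' (T' : measurableType d') (f : T -> T') A :
  measurable_fun setT (f : sub_space X J -> T') -> measurable A ->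
  sigma_of X J (f @^-1` A).
Proof. by move=> mf mA; rewrite -[_ @^-1` _]setTI; exact: mf. Qed.

End sub_space_theory.

(** The factorization on rectangles makes the joint law the product of the marginals, and a product
    measure is by definition the integral of the measures of sections. *)
Lemma law_independent_pair d d1 d2 (T : measurableType d)
    (T1 : measurableType d1) (T2 : measurableType d2) (R : realType)
    (P : probability T R) (X : {mfun T >-> T1}) (Y : {mfun T >-> T2}) :
  (forall A B, measurable A -> measurable B ->
    P (X @^-1` A `&` Y @^-1` B) = (P (X @^-1` A) * P (Y @^-1` B))%E) ->
  forall D, measurable D ->
    P ((fun w => (X w, Y w)) @^-1` D) =
    (\int[distribution P X]_u P (Y @^-1` xsection D u))%E.
Proof.
move=> XY D mD.
have mXY : measurable_fun setT (fun w => (X w, Y w)).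
  by apply: measurable_fun_pair; exact: measurable_funP.
pose m : {measure set (T1 * T2) -> \bar R} :=
  pushforward P (fun w => (X w, Y w)).
transitivity (m mXY D); first by [].
by rewrite -(@product_measure_unique _ _ _ _ _
  (distribution P X) (distribution P Y)).
Qed.

Section history.
Context d (T : measurableType d) (R : realType) (P : probability T R).
Context (I : Type) (J : eqType) (Y : I -> {RV P >-> R}) (X : J -> {RV P >-> R}).
Hypotheses (indX : mutually_independent X) (indYX : independent_families Y X).

Definition with_init (K : set J) : set (I + J) :=
  [set k | match k with inl _ => True | inr j => K j end].

(** Intersections of an event on [Y] and an event on the noises in [K] form a pi-system generating
    the left sigma-algebra, so it suffices to factor the probability of three-fold intersections. *)
Lemma history_independent (K L : set J) : K `&` L = set0 ->
  indep_systems P (sigma_of (join_families Y X) (with_init K)) (sigma_of X L).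
Proof.
move=> KL.
pose G : set (set T) := [set C | exists A B,
  [/\ sigma_of Y setT A, sigma_of X K B & C = A `&` B]].
have mG : G `<=` measurable.
  move=> _ [A [B [sA sB ->]]]; apply: measurableI.
    exact: (@sigma_of_measurable _ _ _ _ Y setT).
  exact: (@sigma_of_measurable _ _ _ _ X K).
have sI I' (Z : I' -> {RV P >-> R}) M A B :
    sigma_of Z M A -> sigma_of Z M B -> sigma_of Z M (A `&` B).
  by move=> sA sB; exact: (@measurableI _ (sub_space Z M)).
have sT I' (Z : I' -> {RV P >-> R}) M : sigma_of Z M setT.
  exact: (@measurableT _ (sub_space Z M)).
have GI : setI_closed G.
  move=> _ _ [A [B [sA sB ->]]] [A' [B' [sA' sB' ->]]].
  exists (A `&` A'), (B `&` B'); split; [exact: sI|exact: sI|].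
  by rewrite setIACA.
have GL : indep_systems P G (sigma_of X L).
  move=> _ C [A [B [sA sB ->]]] sC.
  (* [Y] is independent of the whole noise family, hence of [B]&[C] and not only of [B] and [C]
     separately; then [B] and [C] are split by disjointness of [K] and [L]. *)
  have sBT : sigma_of X setT B by exact: sub_sigma_of sB.
  have sCT : sigma_of X setT C by exact: sub_sigma_of sC.
  rewrite -setIA (indYX sA (sI _ _ _ _ _ sBT sCT)) (indYX sA sBT).
  by rewrite (mutually_independent_sigma_of indX KL sB sC) muleA.
have {}GL := indep_systems_sigma mG GI (@sigma_of_measurable _ _ _ _ X L) GL.
move=> A C sA sC; apply: GL => //; move: A sA; apply: sub_sigma_algebra2.
move=> _ [[i|j] /= Kj [A mA <-]]; rewrite setTI.
  exists (Y i @^-1` A), setT.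
  by split; [exact: sigma_of_preimage|exact: sT|rewrite setIT].
exists setT, (X j @^-1` A).
by split; [exact: sT|exact: sigma_of_preimage|rewrite setTI].
Qed.

End history.

(** * Normal laws *)

Lemma measurable_affine (R : realType) (b c : R) :
  measurable_fun setT
    (fun u : measurableTypeR R => (b + c * u : measurableTypeR R)).
Proof. by apply: measurable_funD => //; exact: measurable_funM. Qed.

(** The right-hand side is a measure in [A] giving half-open intervals their length, which
    characterizes Lebesgue measure. *)
Lemma lebesgue_measure_affine (R : realType) (b c : R) (A : set R) :
  0 < c -> measurable A ->
  (lebesgue_measure A =
    c%:E * lebesgue_measure ((fun u : R => (b + c * u)%R) @^-1` A))%E.
Proof.
move=> c0 mA.
pose f (u : measurableTypeR R) : measurableTypeR R := b + c * u.
have mf : measurable_fun setT f by exact: measurable_affine.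
pose m := mscale (NngNum (ltW c0)) (pushforward (@lebesgue_measure R) f).
transitivity (m mf A); last by [].
apply: lebesgue_measure_unique mA => _ [[x y] _ <-].
change (lebesgue_measure `]x, y] =
  c%:E * lebesgue_measure ((fun u : R => b + c * u)%R @^-1` `]x, y]))%E.
have -> : (fun u : R => b + c * u) @^-1` `]x, y] =
    [set` `](x - b) / c, (y - b) / c]].
  apply/seteqP; split => u /=; rewrite !in_itv/=.
    by rewrite ltr_pdivrMr// ler_pdivlMr// ltrBlDl lerBrDl (mulrC u).
  by rewrite ltr_pdivrMr// ler_pdivlMr// ltrBlDl lerBrDl (mulrC u).
rewrite !lebesgue_measure_itv/= !lte_fin ltr_pM2r ?invr_gt0// ltrD2r.
case: ifP => _; last by rewrite mule0.
by rewrite -!EFinD -EFinM; congr EFin; field; rewrite gt_eqF.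
Qed.

Lemma normal_pdf_affine (R : realType) (m s b c u : R) : 0 < c -> 0 < s ->
  c * normal_pdf (b + c * m) (c * s) (b + c * u) = normal_pdf m s u.
Proof.
move=> c0 s0; rewrite !normal_pdfE ?gt_eqF ?mulr_gt0// /normal_peak /normal_fun.
rewrite mulrA; congr (_ * expR _).
  have -> : (c * s) ^+ 2 * pi *+ 2 = c ^+ 2 * (s ^+ 2 * pi *+ 2) by ring.
  rewrite sqrtrM ?sqr_ge0// sqrtr_sqr gtr0_norm//.
  by rewrite invfM mulrA divff ?mul1r// gt_eqF.
field.
by rewrite !gt_eqF.
Qed.

(** Change of variables in the density. The second parameter of [normal_prob] is the standard
    deviation, hence the factor [c] and not its square. *)
Lemma normal_prob_affine (R : realType) (m s b c : R) (A : set R) :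
  0 < c -> 0 < s -> measurable A ->
  normal_prob m s ((fun u => b + c * u) @^-1` A) =
    normal_prob (b + c * m) (c * s) A.
Proof.
move=> c0 s0 mA.
pose f (u : measurableTypeR R) : measurableTypeR R := b + c * u.
have mf : measurable_fun setT f by exact: measurable_affine.
pose mu := mscale (NngNum (ltW c0)) (pushforward (@lebesgue_measure R) f).
have mpdf m' s' : measurable_fun setT
    (fun x : measurableTypeR R => (normal_pdf m' s' x)%:E).
  by apply/measurable_EFinP; exact: measurable_normal_pdf.
rewrite /normal_prob.
rewrite [RHS](_ : _ = \int[mu mf]_(x in A)
    (normal_pdf (b + c * m) (c * s) x)%:E)%E; last first.
  apply: eq_measure_integral => B mB _.
  exact: (lebesgue_measure_affine b c0 mB).
rewrite ge0_integral_mscale//=; last 2 first.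
- exact: measurable_funTS (mpdf _ _).
- by move=> x _; rewrite lee_fin normal_pdf_ge0.
rewrite ge0_integral_pushforward//; last 2 first.
- exact: measurable_funTS (mpdf _ _).
- by move=> x _; rewrite lee_fin normal_pdf_ge0.
rewrite -ge0_integralZl//=; last 4 first.
- by rewrite -[_ @^-1` _]setTI; exact: mf.
- apply: measurable_funTS; apply: measurableT_comp => //; exact: mpdf.
- by move=> x _; rewrite lee_fin normal_pdf_ge0.
- by rewrite lee_fin ltW.
by apply: eq_integral => x _; rewrite -EFinM normal_pdf_affine.
Qed.

(* Completing the square in the exponent. *)
Lemma normal_pdf_mul (R : realType) (s c u x : R) : 0 < s ->
  let t := Num.sqrt (s ^+ 2 + c ^+ 2) in
  normal_pdf 0 1 u * normal_pdf (c * u) s x =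
  normal_pdf 0 t x * normal_pdf (c * x / t ^+ 2) (s / t) u.
Proof.
move=> s0 t.
have t20 : 0 < s ^+ 2 + c ^+ 2 by rewrite ltr_wpDr ?sqr_ge0// exprn_gt0.
have t0 : 0 < t by rewrite sqrtr_gt0.
have tE : t ^+ 2 = s ^+ 2 + c ^+ 2 by rewrite sqr_sqrtr// ltW.
rewrite !normal_pdfE ?gt_eqF ?divr_gt0// /normal_peak /normal_fun.
rewrite mulrACA [RHS]mulrACA -!expRD; congr (_ * expR _).
  rewrite -!invfM -!sqrtrM; last 2 first.
  - by rewrite mulrn_wge0// mulr_ge0 ?sqr_ge0// pi_ge0.
  - by rewrite mulrn_wge0// mulr_ge0 ?sqr_ge0// pi_ge0.
  by congr (Num.sqrt _)^-1; rewrite expr1n; field; rewrite gt_eqF.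
rewrite expr_div_n tE.
field.
by rewrite !gt_eqF.
Qed.

(** The Radon-Nikodym derivative of the normal law equals its density almost everywhere, both having
    the same integral over every measurable set. *)
Lemma integral_normal_prob (R : realType) (m s : R) (f : R -> \bar R) :
  s != 0 -> (normal_prob m s).-integrable [set: measurableTypeR R] f ->
  (\int[normal_prob m s]_x f x =
   \int[lebesgue_measure]_x (f x * (normal_pdf m s x)%:E))%E.
Proof.
move=> s0 intf; have mf := measurable_int _ intf.
rewrite -(Radon_Nikodym_change_of_variables (normal_prob_dominates m s))//=.
apply: ae_eq_integral => //.
- apply: emeasurable_funM => //; apply: (measurable_int lebesgue_measure).
  by apply: Radon_Nikodym_integrable; exact: normal_prob_dominates.
- apply: emeasurable_funM => //=; apply/measurable_EFinP.
  exact: measurable_normal_pdf.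
- apply: ae_eqe_mul2l => /=.
  rewrite Radon_NikodymE//=; first exact: normal_prob_dominates.
  move=> dom.
  case: cid => /= h [h1 h2 h3].
  apply: integral_ae_eq => //=.
  + by apply/measurable_EFinP; exact: measurable_normal_pdf.
  + by move=> E E01 mE; rewrite -h3.
Qed.

Lemma measurable_normal_pdf_mean (R : realType) (s c : R) : s != 0 ->
  measurable_fun setT (fun z : measurableTypeR R * measurableTypeR R =>
    normal_pdf (c * z.1) s z.2).
Proof.
move=> s0.
have -> : (fun z : measurableTypeR R * measurableTypeR R =>
    normal_pdf (c * z.1) s z.2) = normal_pdf 0 s \o (fun z => z.2 - c * z.1).
  apply/funext => z /=; rewrite !normal_pdfE//.
  by rewrite /normal_fun subr0.
apply: measurableT_comp; first exact: measurable_normal_pdf.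
by apply: measurable_funB => //; exact: measurable_funM.
Qed.

(** If [u] is standard normal and [x] given [u] is normal with mean [c * u] and deviation [s], then
    [x] is centred normal. After Tonelli, [normal_pdf_mul] splits the joint density into the density
    of [x] and a normal density in [u], which integrates to 1. *)
Lemma normal_prob_convolution (R : realType) (s c : R) (A : set R) :
  0 < s -> measurable A ->
  (\int[normal_prob 0 1]_u normal_prob (c * u)%R s A =
   normal_prob 0 (Num.sqrt (s ^+ 2 + c ^+ 2)) A)%E.
Proof.
move=> s0 mA; have sN0 : s != 0 by rewrite gt_eqF.
have t0 : 0 < Num.sqrt (s ^+ 2 + c ^+ 2).
  by rewrite sqrtr_gt0 ltr_wpDr ?sqr_ge0// exprn_gt0.
(* The indicator of [A] is part of the integrand so that both integrals run over the whole line, as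
   Tonelli requires. *)
pose f (z : measurableTypeR R * measurableTypeR R) : \bar R :=
  (\1_A z.2 * normal_pdf (c * z.1) s z.2)%:E.
have f0 z : (0 <= f z)%E by rewrite lee_fin mulr_ge0 ?normal_pdf_ge0.
have mI : measurable_fun setT
    (fun z : measurableTypeR R * measurableTypeR R => \1_A z.2 : R).
  by apply: (measurableT_comp (f := (\1_A : measurableTypeR R -> R))).
have mf : measurable_fun setT f.
  apply/measurable_EFinP; apply: measurable_funM => //.
  exact: measurable_normal_pdf_mean.
have fE u : normal_prob (c * u) s A = (\int[lebesgue_measure]_x f (u, x))%E.
  rewrite /normal_prob integral_mkcond; apply: eq_integral => x _.
  by rewrite /f/= patchE indicE; case: ifP => _; rewrite ?mul1r ?mul0r.
have mN : measurable_fun setT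
    (fun u : measurableTypeR R => normal_prob (c * u) s A).
  under eq_fun do rewrite fE.
  exact: (measurable_fun_fubini_tonelli_F (m2 := lebesgue_measure) f).
rewrite integral_normal_prob ?oner_eq0//; last first.
  apply: (le_integrable _ _ _ (g := cst 1%E)) => //.
    by move=> u _; rewrite /= normr1 gee0_abs// probability_le1.
  apply/integrableP; split => //.
  by rewrite integral_cst//= normr1 mul1e probability_setT ltry.
pose g (z : measurableTypeR R * measurableTypeR R) : \bar R :=
  (f z * (normal_pdf 0 1 z.1)%:E)%E.
have mg : measurable_fun setT g.
  apply: emeasurable_funM => //; apply/measurable_EFinP.
  by apply: measurableT_comp => //; exact: measurable_normal_pdf.
transitivity (\int[lebesgue_measure]_u \int[lebesgue_measure]_x g (u, x))%E.
  apply: eq_integral => u _; rewrite fE -ge0_integralZr//.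
  - exact: (measurableT_comp mf (pair1_measurable u)).
  - by rewrite lee_fin normal_pdf_ge0.
rewrite fubini_tonelli//=; last first.
  by move=> z; rewrite mule_ge0// lee_fin normal_pdf_ge0.
rewrite /normal_prob [RHS]integral_mkcond; apply: eq_integral => x _.
under eq_integral.
  move=> u _; rewrite /g /f/= -EFinM -mulrA (mulrC (normal_pdf _ _ _)).
  rewrite normal_pdf_mul// mulrA EFinM.
  over.
rewrite /= ge0_integralZl//; last 3 first.
- by apply/measurable_EFinP; exact: measurable_normal_pdf.
- by move=> u _; rewrite lee_fin normal_pdf_ge0.
- by rewrite lee_fin mulr_ge0 ?normal_pdf_ge0.
rewrite integral_normal_pdf mule1 patchE indicE.
by case: ifP => _; rewrite ?mul1r ?mul0r.
Qed.

(** Induction on [s]: the new term is independent of the previous sum, so the law is a convolution.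
    The term [X i0] of coefficient 1 keeps the variance positive even if all [c i] vanish. *)
Lemma normal_linear_combination d (T : measurableType d) (R : realType)
    (P : probability T R) (I : eqType) (X : I -> {RV P >-> R})
    (c : I -> R) (i0 : I) (s : seq I) :
  mutually_independent X -> (forall i, standard_normal (X i)) ->
  uniq (i0 :: s) -> forall A, measurable A ->
  P ((fun w => X i0 w + \sum_(i <- s) c i * X i w) @^-1` A) =
  normal_prob 0 (Num.sqrt (1 + \sum_(i <- s) c i ^+ 2)) A.
Proof.
move=> indX normX; elim: s => [|i s IH].
  move=> _ A mA; rewrite big_nil addr0 sqrtr1 -(normX i0)//.
  rewrite /distribution /pushforward; congr (P _).
  by apply/seteqP; split => w; rewrite /= big_nil addr0.
rewrite /= inE negb_or -!andbA => /and4P[i0i i0s iNs us] A mA.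
pose J : set I := [set` i0 :: s].
pose Y w := X i0 w + \sum_(i <- s) c i * X i w.
pose t := Num.sqrt (1 + \sum_(i <- s) c i ^+ 2).
have S0 : 0 < 1 + \sum_(i <- s) c i ^+ 2.
  by rewrite ltr_wpDr// sumr_ge0// => j _; exact: sqr_ge0.
have t0 : 0 < t by rewrite sqrtr_gt0.
have mYJ : measurable_fun setT (Y : sub_space X J -> R).
  have mX j : j \in i0 :: s -> measurable_fun setT (X j : sub_space X J -> R).
    exact: (@sub_space_coord _ _ _ _ X J).
  (* Measurability of a sum is asked of every summand, but [X j] is known to be measurable on
     [sub_space X J] only for [j] in [i0 :: s]; the other summands become 0. *)
  have -> : Y = fun w =>
      X i0 w + \sum_(j <- s) (if j \in s then c j * X j w else 0).
    by apply/funext => w; rewrite -big_mkcond -big_seq.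
  apply: measurable_funD; first exact: (mX i0 (mem_head _ _)).
  apply: measurable_sum => j; case js: (j \in s) => //.
  by apply: measurable_funM => //; apply: (mX j); rewrite inE js orbT.
have mY : measurable_fun setT Y by exact: sub_space_measurable_fun mYJ.
pose Ym : {mfun T >-> R} := HB.pack Y (isMeasurableFun.Build _ _ _ _ Y mY).
(* [normal_prob] is a measure on [measurableTypeR R], which has another display
   than [R]. *)
have mXi : measurable_fun setT (X i : T -> measurableTypeR R).
  by move=> mT B mB; exact: (measurable_funP (X i)) mT B mB.
pose Xi : {mfun T >-> measurableTypeR R} :=
  HB.pack (X i : T -> measurableTypeR R)
    (isMeasurableFun.Build _ _ T (measurableTypeR R) _ mXi).
pose D : set (measurableTypeR R * R) := [set z | A (z.2 + c i * z.1)].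
have mD : measurable D.
  have mg : measurable_fun setT
      (fun z : measurableTypeR R * R => z.2 + c i * z.1).
    apply: measurable_funD; [exact: measurable_snd|].
    apply: measurable_funM; first exact: measurable_cst.
    move=> mT B mB.
    exact: (@measurable_fst _ _ (measurableTypeR R) R mT B mB).
  by rewrite -[D]setTI; exact: mg.
have iJ : [set i] `&` J = set0.
  rewrite -subset0 => _ [/= -> ]; rewrite /J/= inE (negbTE iNs) orbF.
  by rewrite eq_sym (negbTE i0i).
transitivity (P ((fun w => (Xi w, Ym w)) @^-1` D)).
  congr (P _); rewrite /D.
  by apply/seteqP; split => w /=; rewrite big_cons addrCA addrC.
rewrite law_independent_pair//; last first.
  move=> B C mB mC; apply: (mutually_independent_sigma_of indX iJ).
    exact: sigma_of_preimage.
  exact: sub_space_preimage mYJ mC.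
rewrite big_cons addrCA -[1 + _]sqr_sqrtr ?ltW// addrC.
rewrite -normal_prob_convolution//.
transitivity (\int[distribution P Xi]_u normal_prob (c i * u)%R t A)%E.
  (* For a frozen value [u] of [X i], the sum is [Y] translated by [c i * u]: an affine map of slope
     1 applied to the normal law of [Y] given by the induction hypothesis. *)
  apply: eq_integral => u _.
  rewrite -[c i * u]addr0 -{1}(mulr0 1) -[t]mul1r -normal_prob_affine//.
  rewrite -IH//; last 2 first.
  - by rewrite /= i0s.
  - by rewrite -[_ @^-1` _]setTI; exact: (@measurable_affine R (c i * u) 1).
  congr (P _); apply/seteqP; split => y; rewrite /xsection/= inE mul1r addrC//.
by apply: eq_measure_integral => B mB _; exact: normX.
Qed.

(** * Markov chains of lagged values *)

Section path_space.
Context {R : realType}.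

(** Its measurable sets are those on which [same_distribution] compares laws. It serves both for
    trajectories and for histories listed from the latest value backwards. *)
Definition path_space : Type := g_sigma_algebraType
  (\bigcup_n preimage_set_system [set: nat -> R] (fun f => f n) measurable).

HB.instance Definition _ := Measurable.on path_space.

Lemma measurable_coord n : measurable_fun setT (fun f : path_space => f n).
Proof.
move=> _ A mA; apply: sub_sigma_algebra; exists n => //.
by exists A.
Qed.

Lemma measurable_fun_path d (T : measurableType d) (F : T -> path_space) :
  (forall n, measurable_fun setT (fun w => F w n)) -> measurable_fun setT F.
Proof.
move=> mF; apply: measurability; first by [].
move=> _ [_ [n _ [A mA <-]] <-].
by rewrite !setTI -[X in measurable X]setTI; exact: mF.
Qed.

Definition path_cons (r : R) (f : path_space) : path_space :=
  fun n => if n is m.+1 then f m else r.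

Lemma measurable_path_cons d (T : measurableType d) (r : T -> R)
    (F : T -> path_space) :
  measurable_fun setT r -> measurable_fun setT F ->
  measurable_fun setT (fun w => path_cons (r w) (F w)).
Proof.
move=> mr mF; apply: measurable_fun_path => -[|n] //=.
exact: (measurableT_comp (measurable_coord n)).
Qed.

End path_space.
Arguments path_space : clear implicits.

(* [state s0 V n w k] is the value at time [n - k]. *)
Fixpoint state {R : realType} {T : Type} (s0 : T -> path_space R)
    (V : nat -> path_space R -> T -> R) (n : nat) (w : T) : path_space R :=
  if n is m.+1 then path_cons (V m (state s0 V m w) w) (state s0 V m w)
  else s0 w.

Section chain.
Context d (T : measurableType d) (R : realType) (P : probability T R).
Context (I : Type) (J : eqType) (Y : I -> {RV P >-> R}) (X : J -> {RV P >-> R}).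
Hypotheses (indX : mutually_independent X) (indYX : independent_families Y X).
Variables (tau : J -> nat) (s0 : T -> path_space R)
  (V : nat -> path_space R -> T -> R).
(** [tau j] is the step at which noise [j] enters. [V n h w] is the value produced at step [n] from
    the history [h]; by [mV] it depends on [w] only through the noises of [now n], whereas [hist n]
    collects the initial data and the earlier noises. *)
Let now n : set J := [set j | tau j = n].
Let hist n : set (I + J) := with_init [set j | (tau j < n)%N].
Hypothesis ms0 : measurable_fun setT (s0 : sub_space Y setT -> path_space R).
Hypothesis mV : forall n, measurable_fun setT
  (fun z : path_space R * sub_space X (now n) => V n z.1 z.2).

Let YX := join_families Y X.

Lemma measurable_state n :
  measurable_fun setT (state s0 V n : sub_space YX (hist n) -> path_space R).
Proof.
elim: n => [|n IH].
  move=> mT A mA; apply: sub_sigma_algebra2; last exact: ms0 mA.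
  move=> B [i _ Bi]; exists (inl i) => //.
have mid : measurable_fun setT
    (id : sub_space YX (hist n.+1) -> sub_space YX (hist n)).
  apply: (@sub_space_comap _ _ _ _ YX); apply: sub_sigma_of.
  by move=> [//|j] /= /ltnW.
have mst : measurable_fun setT
    (state s0 V n : sub_space YX (hist n.+1) -> path_space R).
  exact: (measurableT_comp IH mid).
have mnow : measurable_fun setT
    (id : sub_space YX (hist n.+1) -> sub_space X (now n)).
  apply: (@sub_space_comap _ _ _ _ X); apply: sub_sigma_algebra2.
  by move=> B [j <- Bj]; exists (inr j) => //=; rewrite /hist/=.
have mVst := measurableT_comp (@mV n) (measurable_fun_pair mst mnow).
exact: (measurable_path_cons mVst mst).
Qed.

Lemma measurable_stateT n :
  measurable_fun setT (state s0 V n : T -> path_space R).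
Proof. exact: (sub_space_measurable_fun (X := YX) (@measurable_state n)). Qed.

HB.instance Definition _ n := isMeasurableFun.Build _ _ T (path_space R)
  (state s0 V n) (measurable_stateT n).

(** The Markov property: the state at time [n] is independent of the noises of step [n], so the next
    law is the integral of the transition probabilities. *)
Lemma state_step n B : measurable B ->
  P (state s0 V n.+1 @^-1` B) =
  (\int[distribution P (state s0 V n)]_h
    P [set w | B (path_cons (V n h w) h)])%E.
Proof.
move=> mB.
pose G := sub_space X (now n).
have mid : measurable_fun setT (id : T -> G) by exact: sub_space_id.
(* The noises of step [n] are packed into one random element, the identity from [T] to [T] with
   their sigma-algebra. *)
pose idM : {mfun T >-> G} :=
  HB.pack (id : T -> G) (isMeasurableFun.Build _ _ T G id mid).
pose D : set (path_space R * G) := [set z | B (path_cons (V n z.1 z.2) z.1)].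
have mD : measurable D.
  have mg : measurable_fun setT
      (fun z : path_space R * G => path_cons (V n z.1 z.2) z.1).
    by apply: measurable_path_cons => //; exact: mV.
  by rewrite -[D]setTI; exact: mg.
transitivity (P ((fun w => (state s0 V n w, idM w)) @^-1` D)); first by [].
rewrite (law_independent_pair (X := state s0 V n) (Y := idM))//.
  apply: eq_integral => h _; congr (P _).
  by apply/seteqP; split => w; rewrite /xsection/= inE.
move=> A C mA mC; apply: (history_independent indX indYX
  (K := [set j | (tau j < n)%N]) (L := now n)).
- by rewrite -subset0 => j [/= + jn]; rewrite jn ltnn.
- by apply: sub_space_preimage mA; exact: measurable_state.
- exact: mC.
Qed.

End chain.

Lemma eq_state_law d (T : measurableType d) (R : realType)
    (P : probability T R) (I : Type) (J1 J2 : eqType) (Y : I -> {RV P >-> R})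
    (X1 : J1 -> {RV P >-> R}) (X2 : J2 -> {RV P >-> R})
    (tau1 : J1 -> nat) (tau2 : J2 -> nat) (s0 : T -> path_space R)
    (V1 V2 : nat -> path_space R -> T -> R) :
  mutually_independent X1 -> mutually_independent X2 ->
  independent_families Y X1 -> independent_families Y X2 ->
  measurable_fun setT (s0 : sub_space Y setT -> path_space R) ->
  (forall n, measurable_fun setT
    (fun z : path_space R * sub_space X1 [set j | tau1 j = n] =>
      V1 n z.1 z.2)) ->
  (forall n, measurable_fun setT
    (fun z : path_space R * sub_space X2 [set j | tau2 j = n] =>
      V2 n z.1 z.2)) ->
  (forall n h A, measurable A -> P (V1 n h @^-1` A) = P (V2 n h @^-1` A)) ->
  forall n B, measurable B ->
    P (state s0 V1 n @^-1` B) = P (state s0 V2 n @^-1` B).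
Proof.
move=> iX1 iX2 iYX1 iYX2 ms0 mV1 mV2 V12; elim=> [//|n IH] B mB.
rewrite (state_step iX1 iYX1 ms0 mV1)// (state_step iX2 iYX2 ms0 mV2)//.
have V12h h : P [set w | B (path_cons (V1 n h w) h)] =
              P [set w | B (path_cons (V2 n h w) h)].
  apply: (V12 n h [set r | B (path_cons r h)]).
  have mc : measurable_fun setT (fun r : R => path_cons r h).
    by apply: measurable_path_cons => //; exact: measurable_cst.
  by rewrite -[X in measurable X]setTI; exact: mc.
(* The transition probabilities are exchanged first, then the law of the current state by
   induction. *)
under eq_integral do rewrite V12h.
by apply: eq_measure_integral => A mA _; exact: IH.
Qed.

Section lagged_state.
Context {R : realType} {T : Type}.
Variables (s0 : T -> path_space R) (V : nat -> path_space R -> T -> R).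

Lemma state_lag m k w : state s0 V (m + k) w k = state s0 V m w 0%N.
Proof. by elim: k => [|k IH]; rewrite ?addn0// addnS. Qed.

Lemma state_recurrence q (z : int -> T -> R) : (0 < q)%N ->
  (forall n (h h' : path_space R) w, (forall k, (k < q)%N -> h k = h' k) ->
    V n h w = V n h' w) ->
  (forall k w, (k < q)%N -> z (- k%:Z) w = s0 w k) ->
  (forall n w, z n.+1%:Z w = V n (fun k => z (n%:Z - k%:Z) w) w) ->
  forall n w, z n%:Z w = state s0 V n w 0%N.
Proof.
move=> q0 Vq z0 zS n w.
(* The induction needs all lags below [q], not just lag 0. Larger lags are excluded: there [z] is
   not tied to [s0], and [Vq] says that [V] does not read them. *)
suff zE k : (k < q)%N -> z (n%:Z - k%:Z) w = state s0 V n w k.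
  by rewrite -zE// subr0.
elim: n k => [|n IH] [|k] kq.
- by rewrite sub0r z0.
- by rewrite sub0r z0.
- by rewrite subr0 zS; apply: Vq => k kq'; exact: IH.
- rewrite -[RHS]/(state s0 V n w k) -IH ?(ltnW kq)//; congr (z _ w).
  by rewrite -addn1 -(addn1 k) !PoszD opprD addrACA subrr addr0.
Qed.

End lagged_state.

(** The state at time [N] contains all values up to time [N], so equality of the laws of single
    states already gives that of all finite-dimensional distributions, and these determine the law
    on path space. *)
Lemma same_distribution_state d (T : measurableType d) (R : realType)
    (P : probability T R) (s1 s2 : T -> path_space R)
    (V1 V2 : nat -> path_space R -> T -> R) :
  (forall n, measurable_fun setT (state s1 V1 n)) ->
  (forall n, measurable_fun setT (state s2 V2 n)) ->
  (forall n B, measurable B ->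
    P (state s1 V1 n @^-1` B) = P (state s2 V2 n @^-1` B)) ->
  same_distribution P (fun n w => state s1 V1 n w 0%N)
    (fun n w => state s2 V2 n w 0%N).
Proof.
move=> mS1 mS2 S12 A mA.
pose Z1 w : path_space R := fun n => state s1 V1 n w 0%N.
pose Z2 w : path_space R := fun n => state s2 V2 n w 0%N.
have mZ1 : measurable_fun setT Z1.
  apply: measurable_fun_path => n.
  exact: (measurableT_comp (measurable_coord 0)).
have mZ2 : measurable_fun setT Z2.
  apply: measurable_fun_path => n.
  exact: (measurableT_comp (measurable_coord 0)).
pose m1 : {measure set (path_space R) -> \bar R} := pushforward P Z1.
pose m2 : {measure set (path_space R) -> \bar R} := pushforward P Z2.
pose coord (n : nat) (f : path_space R) : R := f n.
have mcyl (D : set nat) (B : nat -> set R) (g : nat -> nat) : finite_set D ->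
    (forall i, measurable (B i)) ->
    measurable (\bigcap_(i in D) coord (g i) @^-1` B i).
  move=> fD mB; apply: fin_bigcap_measurable => // i _.
  by rewrite -[_ @^-1` _]setTI; exact: measurable_coord.
apply: (@eq_finite_measure_pi _ _ _ (m1 mZ1) (m2 mZ2) (cylinder coord setT)).
- by move=> _ [D [B [fD _ mB ->]]]; exact: (mcyl _ _ id).
- exact: cylinder_setI.
- by rewrite /m1 /m2/= /pushforward !preimage_setT.
- by rewrite /m1/= /pushforward preimage_setT probability_setT ltry.
- move=> _ [D [B [fD _ mB ->]]].
  have /finite_seqP[s DE] := fD.
  pose N := \max_(i <- s) i.
  have sN i : D i -> (i <= N)%N.
    by rewrite DE => si; exact: leq_bigmax_seq.
  have preE s0 V (w : T) i : D i ->
      state s0 V i w 0%N = state s0 V N w (N - i)%N :> R.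
    by move=> /sN iN; rewrite -{1}(subnKC iN) state_lag.
  (* The cylinder as an event on the state at time [N], where the value at time [i] sits at lag
     [N - i]. *)
  pose C := \bigcap_(i in D) coord (N - i)%N @^-1` B i.
  transitivity (P (state s1 V1 N @^-1` C)).
    congr (P _); apply/seteqP; split => w wB i Di; have := wB i Di;
      by rewrite /coord/= /Z1 preE.
  rewrite S12; last exact: (mcyl _ _ (fun i => N - i)%N).
  congr (P _); apply/seteqP; split => w wB i Di; have := wB i Di;
    by rewrite /coord/= /Z2 preE.
- exact: sigma_of_cylinder mA.
Qed.

(** * The two recurrences *)

Lemma normal_affine_law d (T : measurableType d) (R : realType)
    (P : probability T R) (f : T -> R) (s b c : R) : 0 < s -> 0 < c ->
  (forall A, measurable A -> P (f @^-1` A) = normal_prob 0 s A) ->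
  forall A, measurable A ->
    P ((fun w => b + c * f w) @^-1` A) = normal_prob b (c * s) A.
Proof.
move=> s0 c0 fN A mA.
rewrite -[b in RHS]addr0 -{1}(mulr0 c) -normal_prob_affine// -fN//.
by rewrite -[_ @^-1` _]setTI; exact: (@measurable_affine R b c).
Qed.

Section autoregression.
Context {R : realType} {q : nat}.
Variables (a sigma : 'I_q -> R).

Definition arch_step (e : R) (h : path_space R) : R :=
  \sum_(i < q) a i * h i
  + Num.sqrt (1 + \sum_(i < q) sigma i ^+ 2 * h i ^+ 2) * e.

Definition random_coef_step (u : 'I_q -> R) (e : R) (h : path_space R) : R :=
  \sum_(i < q) (a i + sigma i * u i) * h i + e.

Lemma measurable_arch_step d (T : measurableType d) (e : T -> R)
    (h : T -> path_space R) :
  measurable_fun setT e -> measurable_fun setT h ->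
  measurable_fun setT (fun w => arch_step (e w) (h w)).
Proof.
move=> me mh.
have mhi (i : 'I_q) : measurable_fun setT (fun w => h w i).
  exact: (measurableT_comp (measurable_coord i) mh).
apply: measurable_funD.
  by apply: measurable_sum => i; exact: measurable_funM.
apply: measurable_funM => //.
have msqrt : measurable_fun setT (@Num.sqrt R).
  by apply: continuous_measurable_fun; exact: sqrt_continuous.
apply: (measurableT_comp msqrt).
apply: measurable_funD => //; apply: measurable_sum => i.
by apply: measurable_funM => //; exact: measurable_funX.
Qed.

Lemma measurable_random_coef_step d (T : measurableType d) (u : 'I_q -> T -> R)
    (e : T -> R) (h : T -> path_space R) :
  (forall i, measurable_fun setT (u i)) ->
  measurable_fun setT e -> measurable_fun setT h ->
  measurable_fun setT (fun w => random_coef_step (u ^~ w) (e w) (h w)).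
Proof.
move=> mu me mh; apply: measurable_funD => //; apply: measurable_sum => i.
apply: measurable_funM; last exact: (measurableT_comp (measurable_coord i) mh).
by apply: measurable_funD => //; exact: measurable_funM.
Qed.

Context d (T : measurableType d) (P : probability T R).

(** For a frozen history the step is affine in the noise, with a positive slope since the quantity
    under the root is at least 1. *)
Lemma arch_step_law (e : {RV P >-> R}) (h : path_space R) A :
  standard_normal e -> measurable A ->
  P ((fun w => arch_step (e w) h) @^-1` A) =
  normal_prob (\sum_(i < q) a i * h i)
    (Num.sqrt (1 + \sum_(i < q) (sigma i * h i) ^+ 2)) A.
Proof.
move=> eN mA.
have -> : \sum_(i < q) (sigma i * h i) ^+ 2 =
    \sum_(i < q) sigma i ^+ 2 * h i ^+ 2.
  by apply: eq_bigr => i _; rewrite exprMn.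
rewrite -[Num.sqrt _ in RHS]mulr1 -(@normal_affine_law _ _ _ P e)//.
by rewrite sqrtr_gt0 ltr_wpDr// sumr_ge0// => i _; rewrite mulr_ge0 ?sqr_ge0.
Qed.

Lemma random_coef_step_law (J : eqType) (X : J -> {RV P >-> R})
    (u : 'I_q -> J) (j0 : J) (h : path_space R) A :
  mutually_independent X -> (forall j, standard_normal (X j)) ->
  injective u -> (forall i, u i != j0) -> measurable A ->
  P ((fun w => random_coef_step (fun i => X (u i) w) (X j0 w) h) @^-1` A) =
  normal_prob (\sum_(i < q) a i * h i)
    (Num.sqrt (1 + \sum_(i < q) (sigma i * h i) ^+ 2)) A.
Proof.
move=> indX XN u_inj uj0 mA.
(* The coefficients [sigma i * h i] transported along the injection [u], with default 0, since
   linear combinations take coefficients indexed by all of [J]. *)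
pose c j := if [pick i | u i == j] is Some i then sigma i * h i else 0.
have cu i : c (u i) = sigma i * h i.
  rewrite /c; case: pickP => [k /eqP/u_inj->//|/(_ i)].
  by rewrite eqxx.
pose s := [seq u i | i <- enum 'I_q].
have us : uniq (j0 :: s).
  rewrite /= map_inj_uniq// enum_uniq andbT.
  by apply/mapP => -[i _ j0E]; have := uj0 i; rewrite -j0E eqxx.
have sE (F : J -> R) : \sum_(j <- s) F j = \sum_(i < q) F (u i).
  by rewrite big_map big_enum.
(* The deterministic part is separated from the noise; the factor 1 matches the affine form of
   [normal_affine_law]. *)
have stepE w : random_coef_step (fun i => X (u i) w) (X j0 w) h =
    \sum_(i < q) a i * h i + 1 * (X j0 w + \sum_(j <- s) c j * X j w).
  rewrite /random_coef_step mul1r sE addrCA addrC -big_split/=; congr (_ + _).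
  by apply: eq_bigr => i _; rewrite cu mulrDl mulrAC.
rewrite (_ : _ @^-1` A = (fun w => \sum_(i < q) a i * h i +
    1 * (X j0 w + \sum_(j <- s) c j * X j w)) @^-1` A); last first.
  by apply/seteqP; split => w; rewrite /= stepE.
rewrite (normal_affine_law _ _ _ (normal_linear_combination c indX XN us))//.
  rewrite mul1r sE; congr (normal_prob _ (Num.sqrt (1 + _)) A).
  by apply: eq_bigr => i _; rewrite cu.
by rewrite sqrtr_gt0 ltr_wpDr// sumr_ge0// => j _; exact: sqr_ge0.
Qed.

End autoregression.

(* Noise indices are shifted to start from 0: for [i : 'I_q] and [n : nat],
   [a i], [sigma i], [eta (i, n)], [xi n], [eps n] stand for a_{i+1},
   sigma_{i+1}, eta_{i+1,n+1}, xi_{n+1}, eps_{n+1}, and [y0 i] for y_{-i}.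
   The processes [x] and [y] carry their original time index; their values at
   times <= -q are unconstrained and unused. *)
Theorem lemma2p7 (d : measure_display) (T : measurableType d) (R : realType)
    (P : probability T R) (q : nat) (hq : (0 < q)%N)
    (a sigma : 'I_q -> R) (hsigma : forall i : 'I_q, 0 <= sigma i)
    (eta : 'I_q * nat -> {RV P >-> R}) (xi eps : nat -> {RV P >-> R})
    (y0 : 'I_q -> {RV P >-> R}) (x y : int -> T -> R)
    (eta_normal : forall k : 'I_q * nat, standard_normal (eta k))
    (xi_normal : forall n : nat, standard_normal (xi n))
    (noise_indep : mutually_independent (join_families eta xi))
    (y0_indep_noise : independent_families y0 (join_families eta xi))
    (y_init : forall (i : 'I_q) (w : T), y (- i%:Z) w = y0 i w)
    (y_rec : forall (n : nat) (w : T),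
       y n.+1%:Z w =
         \sum_(i < q) (a i + sigma i * eta (i, n) w) * y (n%:Z - i%:Z) w
         + xi n w)
    (eps_normal : forall n : nat, standard_normal (eps n))
    (eps_indep : mutually_independent eps)
    (y0_indep_eps : independent_families y0 eps)
    (x_init : forall (i : 'I_q) (w : T), x (- i%:Z) w = y0 i w)
    (x_rec : forall (n : nat) (w : T),
       x n.+1%:Z w =
         \sum_(i < q) a i * x (n%:Z - i%:Z) w
         + Num.sqrt (1 + \sum_(i < q) sigma i ^+ 2 * x (n%:Z - i%:Z) w ^+ 2)
           * eps n w) :
  same_distribution P (fun n : nat => x n%:Z) (fun n : nat => y n%:Z).
Proof.
(* Beyond lag [q - 1] the initial history is padded with 0, a value which neither step function
   reads. *)
pose s0 w : path_space R := fun k => if insub k is Some i then y0 i w else 0.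
pose Vx n (h : path_space R) w := arch_step a sigma (eps n w) h.
pose Vy n (h : path_space R) w :=
  random_coef_step a sigma (fun i => eta (i, n) w) (xi n w) h.
pose noise := join_families eta xi.
pose tau (j : 'I_q * nat + nat) := match j with inl k => k.2 | inr n => n end.
have s0E (z : int -> T -> R) : (forall (i : 'I_q) w, z (- i%:Z) w = y0 i w) ->
    forall k w, (k < q)%N -> z (- k%:Z) w = s0 w k.
  by move=> z0 k w kq; rewrite /s0 insubT/= -z0.
have ms0 : measurable_fun setT (s0 : sub_space y0 setT -> path_space R).
  apply: measurable_fun_path => k; rewrite /s0; case: insubP => [i _ _|_].
    exact: (@sub_space_coord _ _ _ _ y0).
  exact: measurable_cst.
have mVx n : measurable_fun setT
    (fun z : path_space R * sub_space eps [set j | j = n] => Vx n z.1 z.2).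
  apply: measurable_arch_step => //.
  have me : measurable_fun setT (eps n : sub_space eps [set j | j = n] -> R).
    exact: (@sub_space_coord _ _ _ _ eps).
  exact: (measurableT_comp me measurable_snd).
have mVy n : measurable_fun setT
    (fun z : path_space R * sub_space noise [set j | tau j = n] =>
      Vy n z.1 z.2).
  have mn j : tau j = n ->
      measurable_fun setT (noise j : sub_space noise [set j | tau j = n] -> R).
    exact: (@sub_space_coord _ _ _ _ noise).
  apply: measurable_random_coef_step => //.
    move=> i.
    exact: (measurableT_comp (mn (inl (i, n)) erefl) measurable_snd).
  exact: (measurableT_comp (mn (inr n) erefl) measurable_snd).
(* Both transition laws are computed as the same normal law, with the mean and variance determined
   by [h]. *)
have Vxy n h A : measurable A -> P (Vx n h @^-1` A) = P (Vy n h @^-1` A).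
  move=> mA; rewrite arch_step_law//.
  rewrite -(@random_coef_step_law _ _ a sigma _ _ _ _ noise
    (fun i => inl (i, n)) (inr n))//.
    by case.
  by move=> i j [].
have xE n w : x n%:Z w = state s0 Vx n w 0%N.
  apply: (state_recurrence hq) => //; last exact: s0E.
  move=> m h h' u hh'; rewrite /Vx /arch_step.
  congr (_ + Num.sqrt (1 + _) * _); apply: eq_bigr => i _; rewrite hh'//.
have yE n w : y n%:Z w = state s0 Vy n w 0%N.
  apply: (state_recurrence hq) => //; last exact: s0E.
  move=> m h h' u hh'; rewrite /Vy /random_coef_step.
  by congr (_ + _); apply: eq_bigr => i _; rewrite hh'.
have -> : (fun n : nat => x n%:Z) = fun n w => state s0 Vx n w 0%N.
  by apply/funext => n; apply/funext => w; exact: xE.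
have -> : (fun n : nat => y n%:Z) = fun n w => state s0 Vy n w 0%N.
  by apply/funext => n; apply/funext => w; exact: yE.
apply: same_distribution_state.
- exact: (measurable_stateT ms0 mVx).
- exact: (measurable_stateT ms0 mVy).
- exact: (eq_state_law eps_indep noise_indep y0_indep_eps y0_indep_noise
    ms0 mVx mVy Vxy).
Qed.
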